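(* Let $K\subseteq L$ be a finite field extension of degree $n>1$. Then $$\mathcal{C}(L/K)\le n-d_{\max}(L/K).$$
   Context: Let $K\subseteq L$ be a finite field extension with $[L:K]>1$. A nonzero $K$-subspace $A\subseteq L$ is called a Chowla subspace if $[K(a):K]>\dim_K A$ for every $0\ne a\in A$. Define $\mathcal{C}(L/K)=\max\{\dim_K A:A\subseteq L\text{ is a Chowla }K\text{-subspace}\}$ and $d_{\max}(L/K)=\max\{[E:K]:K\subseteq E\subsetneq L\}$, the maximum over proper intermediate fields $E$ (with $E=K$ allowed). *)

(* Defs.v *)
From HB Require Import structures.
From mathcomp Require Import all_boot all_order all_algebra all_field.
From mathcomp Require Import boolp.

Set Implicit Arguments.
Unset Strict Implicit.
Unset Printing Implicit Defensive.

Import GRing.Theory.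
Local Open Scope ring_scope.

Definition is_chowla (K : fieldType) (L : fieldExtType K)
    (A : {vspace L}) : Prop :=
  A <> 0%VS /\
  forall a : L, a \in A -> a != 0 -> (\dim A < \dim <<1%VS; a>>%VS)%N.

Definition is_proper_subfield (K : fieldType) (L : fieldExtType K)
    (U : {vspace L}) : Prop :=
  exists2 E : {subfield L}, U = E :> {vspace L} & U <> fullv.

(* The K-subspaces of L need not form a finite type, so the maximum is taken
   over the possible dimensions 0, ..., [L : K].  It is 0 when no subspace
   satisfies P; [max_dim_ub] and [max_dim_attained] show that it is a genuine
   maximum otherwise. *)
Definition max_dim (K : fieldType) (L : fieldExtType K)
    (P : {vspace L} -> Prop) : nat :=
  (\max_(k < (\dim {:L}).+1 | `[< exists2 U, P U & \dim U = k >]) k)%N.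

Definition chowla_number (K : fieldType) (L : fieldExtType K) : nat :=
  max_dim (@is_chowla K L).

Definition d_max (K : fieldType) (L : fieldExtType K) : nat :=
  max_dim (@is_proper_subfield K L).

Arguments chowla_number {K} L.
Arguments d_max {K} L.

Lemma max_dim_ub (K : fieldType) (L : fieldExtType K)
    (P : {vspace L} -> Prop) (U : {vspace L}) :
  P U -> (\dim U <= max_dim P)%N.
Proof.
move=> PU; have ltU : (\dim U < (\dim {:L}).+1)%N by rewrite ltnS dimvS ?subvf.
rewrite /max_dim; apply: (@leq_bigmax_cond _ _ _ (Ordinal ltU)).
by apply/asboolP; exists U.
Qed.

Lemma max_dim_attained (K : fieldType) (L : fieldExtType K)
    (P : {vspace L} -> Prop) :
  (exists U, P U) -> exists2 U, P U & \dim U = max_dim P.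
Proof.
case=> U PU; have ltU : (\dim U < (\dim {:L}).+1)%N by rewrite ltnS dimvS ?subvf.
pose Q := [pred k : 'I_(\dim {:L}).+1 | `[< exists2 U, P U & \dim U = k >]].
have Q0 : (0 < #|Q|)%N.
  by apply/card_gt0P; exists (Ordinal ltU); apply/asboolP; exists U.
by rewrite /max_dim; have [k /asboolP Qk ->] := eq_bigmax_cond val Q0.
Qed.

Lemma exists_chowla (K : fieldType) (L : fieldExtType K) :
  (1 < \dim {:L})%N -> exists A : {vspace L}, is_chowla A.
Proof.
move=> L_gt1.
have /subvPn[a _ a_notin1] : ~~ ({:L} <= 1)%VS.
  by apply/negP=> /dimvS; rewrite dimv1 leqNgt L_gt1.
have a0 : a != 0 by apply: contraNneq a_notin1 => ->; rewrite mem0v.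
exists <[a]>%VS; split.
  by move/eqP; rewrite -dimv_eq0 dim_vline a0.
move=> b /vlineP[c ->] ca0; rewrite dim_vline a0.
have c0 : c != 0 by apply: contraNneq ca0 => ->; rewrite scale0r.
rewrite ltnNge; apply/negP => dim_le1.
have /eqP eq1 : 1%VS == <<1%VS; c *: a>>%VS :> {vspace L}.
  by rewrite eqEdim sub1v dimv1.
have := memv_adjoin 1%VS (c *: a); rewrite -eq1 rpredZeq (negPf c0).
by rewrite (negPf a_notin1).
Qed.

Lemma exists_proper_subfield (K : fieldType) (L : fieldExtType K) :
  (1 < \dim {:L})%N -> exists U : {vspace L}, is_proper_subfield U.
Proof.
move=> L_gt1; exists 1%VS, 1%AS => // L1.
by move: L_gt1; rewrite -L1 dimv1.
Qed.

(* In particular the truncated difference [L : K] - d_max L is a true one. *)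
Lemma ltn_d_max (K : fieldType) (L : fieldExtType K) :
  (1 < \dim {:L})%N -> (d_max L < \dim {:L})%N.
Proof.
move=> L_gt1; rewrite /d_max.
have [U [E _ /eqP UL] <-] := max_dim_attained (exists_proper_subfield L_gt1).
by rewrite ltnNge; apply: contra UL => leLU; rewrite eqEdim subvf.
Qed.

(* Main.v *)
Require Import Defs.
From mathcomp Require Import all_boot all_order all_algebra all_field.

(** Let A be a Chowla subspace and E a proper intermediate field.  Either A
    and E meet only in 0, and then A + E has dimension dim A + [E : K], which
    is at most [L : K]; or they share some a <> 0, and then
    dim A < [K(a) : K] <= [E : K], while [E : K] is a proper divisor of [L : K]
    and hence at most half of it.  In both cases dim A + [E : K] <= [L : K]
    ([chowla_add_proper_subfield]), and the theorem is the case where A and E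
    have maximal dimension. *)

(** By the tower law [L : K] is a multiple of [E : K], and the factor [L : E]
    is at least 2. *)
Lemma dim_proper_subfield_double (K : fieldType) (L : fieldExtType K)
    (E : {subfield L}) :
  E <> fullv :> {vspace L} -> (\dim E + \dim E <= \dim {:L})%N.
Proof.
move=> /eqP E_proper; have /dvdnP[q dimLq] := field_dimS (subvf E).
have ltEL : (\dim E < \dim {:L})%N.
  by rewrite ltnNge; apply: contra E_proper => leLE; rewrite eqEdim subvf.
rewrite addnn -mul2n dimLq leq_mul2r; apply/orP; right.
by case: q dimLq => [|[|q]] // dimLq; move: ltEL; rewrite dimLq ?mul1n ?ltnn.
Qed.

(** A nonzero a in both A and E caps dim A by [E : K], since K(a) lies in E;
    so the only way for A to be larger than E is to be disjoint from it. *)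
Lemma chowla_add_proper_subfield (K : fieldType) (L : fieldExtType K)
    (A : {vspace L}) (E : {subfield L}) :
  is_chowla A -> E <> fullv :> {vspace L} -> (\dim A + \dim E <= \dim {:L})%N.
Proof.
move=> [_ chowlaA] E_proper.
have [AE0 | AE_neq0] := eqVneq (A :&: E)%VS 0%VS.
  by rewrite -dimv_disjoint_sum // dimvS ?subvf.
have: vpick (A :&: E)%VS \in (A :&: E)%VS by apply: memv_pick.
rewrite memv_cap => /andP[aA aE].
have := chowlaA _ aA; rewrite vpick0 => /(_ AE_neq0) ltA.
have leaE : (<<1; vpick (A :&: E)>> <= E)%VS.
  by apply/FadjoinP; rewrite sub1v.
apply: leq_trans (dim_proper_subfield_double _ _ _ E_proper).
by rewrite leq_add2r ltnW // (leq_trans ltA) // dimvS.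
Qed.

Theorem theorem4p4 (K : fieldType) (L : fieldExtType K) (n : nat)
    (dimL : \dim {:L} = n) (n_gt1 : (1 < n)%N) :
  (chowla_number L <= n - d_max L)%N.
Proof.
subst n; rewrite leq_subRL; last exact: ltnW (ltn_d_max n_gt1).
rewrite addnC /chowla_number /d_max.
have [A chowlaA <-] := max_dim_attained (exists_chowla n_gt1).
have [_ [E -> E_proper] <-] := max_dim_attained (exists_proper_subfield n_gt1).
exact: chowla_add_proper_subfield.
Qed.
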